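(* Let $d=d_1+\cdots+d_r\geq 2$ and let $d_\ell:=\min\{d_1,\ldots,d_r\}$. For a geodesic $\gamma$ of $\mathbb X_{\mathbf n,\mathbf d}$ parametrized by arc length, define its curvature at $t$ as $\kappa_\gamma(t):=\|P_{\gamma(t)}(\gamma''(t))\|$, where $P_{\gamma(t)}$ is the orthogonal projection onto the normal space $N_{\gamma(t)}\mathbb X_{\mathbf n,\mathbf d}$. Then for every such geodesic and every $t$, $$\sqrt{\tfrac{2(d_\ell-1)}{d_\ell}}\;\leq\;\kappa_\gamma(t)\;\leq\;\sqrt{\tfrac{2(d-1)}{d}}.$$ The upper bound is attained by the geodesics $\gamma=\gamma_1\otimes\cdots\otimes\gamma_r$ where each $\gamma_i$ is a geodesic of $\mathbb V_{n_i,d_i}$ of constant speed $\|\gamma_i'(t)\|=\sqrt{d_i/d}$. The lower bound is attained by the geodesics $\gamma=\gamma_1\otimes\cdots\otimes\gamma_r$ where $\gamma_\ell$ is a geodesic of $\mathbb V_{n_\ell,d_\ell}$ parametrized by arc length and all other $\gamma_i$ are constant.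
   Context: $H_{n,d}$ is the space of real homogeneous polynomials of degree $d$ in $x_0,\ldots,x_n$ with the Bombieri–Weyl inner product (the scaled monomials $\mathbf m_\alpha=\sqrt{\binom{d}{\alpha}}x^\alpha$ are orthonormal). $\mathbb V_{n,d}:=\{\pm\ell^d:\ell\text{ linear form}\}\cap\{\|f\|=1\}$. $\mathscr H_{\mathbf n,\mathbf d}:=H_{n_1,d_1}\otimes\cdots\otimes H_{n_r,d_r}$ with inner product $\langle f_1\otimes\cdots\otimes f_r,g_1\otimes\cdots\otimes g_r\rangle=\prod_i\langle f_i,g_i\rangle$, and $\mathbb X_{\mathbf n,\mathbf d}:=\{f_1\otimes\cdots\otimes f_r:f_i\in\mathbb V_{n_i,d_i}\}$, a smooth submanifold of the unit sphere $\mathbb S(\mathscr H_{\mathbf n,\mathbf d})$ with the induced Riemannian metric. For $G\in\mathbb X_{\mathbf n,\mathbf d}$, the normal space $N_G\mathbb X_{\mathbf n,\mathbf d}$ is the orthogonal complement of $T_G\mathbb X_{\mathbf n,\mathbf d}$ inside $T_G\mathbb S(\mathscr H_{\mathbf n,\mathbf d})=G^\perp$. *)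

(* Defs.v *)
From HB Require Import structures.
From mathcomp Require Import all_boot all_order all_algebra.
From mathcomp Require Import mpoly.
From mathcomp Require Import all_classical all_reals all_analysis.

Set Implicit Arguments.
Unset Strict Implicit.
Unset Printing Implicit Defensive.

Import Order.TTheory GRing.Theory Num.Theory.
Local Open Scope classical_set_scope.
Local Open Scope ring_scope.

(* A finite-dimensional real inner product space is realized as {ffun J -> R}
   (coordinates w.r.t. an orthogonal basis) with <f,g> = sum_j w j * f j * g j. *)
Section Geometry.
Context {R : realType} {J : finType}.
Implicit Types (w : J -> R) (f g : {ffun J -> R}) (M S : set {ffun J -> R}).

Definition ipw w f g : R := \sum_j w j * f j * g j.
Definition nrmw w f : R := Num.sqrt (ipw w f f).

Definition curve_derivable (c : R -> {ffun J -> R}) (t : R) : Prop :=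
  forall j, derivable (fun s => c s j) t 1.
Definition dcurve (c : R -> {ffun J -> R}) : R -> {ffun J -> R} :=
  fun t => [ffun j => derive1 (fun s => c s j) t].

Definition tangent_space M (G : {ffun J -> R}) : set {ffun J -> R} :=
  [set v | exists c : R -> {ffun J -> R},
     (forall t, M (c t)) /\ c 0 = G /\ curve_derivable c 0 /\ v = dcurve c 0].

(* normal space of M inside T_G S = G^perp *)
Definition normal_space w M G : set {ffun J -> R} :=
  [set u | ipw w u G = 0 /\ forall v, tangent_space M G v -> ipw w u v = 0].

Definition orth_proj w S (x : {ffun J -> R}) : {ffun J -> R} :=
  xget 0 [set p | S p /\ forall s, S s -> ipw w (x - p) s = 0].

Definition is_geodesic w M (c : R -> {ffun J -> R}) : Prop :=
  (forall t, M (c t)) /\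
  (forall t, curve_derivable c t) /\
  (forall t, curve_derivable (dcurve c) t) /\
  (forall t v, tangent_space M (c t) v -> ipw w (dcurve (dcurve c) t) v = 0).

Definition arc_length w (c : R -> {ffun J -> R}) : Prop :=
  forall t, nrmw w (dcurve c t) = 1.

Definition curvature w M (c : R -> {ffun J -> R}) (t : R) : R :=
  nrmw w (orth_proj w (normal_space w M (c t)) (dcurve (dcurve c) t)).

End Geometry.

(* exponent vectors alpha of monomials x^alpha of degree d in x_0..x_n *)
Definition mon (n d : nat) : finType :=
  {a : {ffun 'I_n.+1 -> 'I_d.+1} | (\sum_j (a j : nat))%N == d}.

(* an element f = sum_alpha f_alpha x^alpha of H_{n,d} is its coefficient vector *)
Definition Hpoly (R : realType) (n d : nat) := {ffun mon n d -> R}.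

(* 1 / binom(d, alpha) = (prod_j alpha_j!) / d! *)
Definition bw_weight (R : realType) (n d : nat) (a : mon n d) : R :=
  ((\prod_j ((val a j : nat)`!))%N)%:R / (d`!)%:R.

Definition mon_to_multinom (n d : nat) (a : mon n d) : mpoly.multinom n.+1 :=
  mpoly.Multinom [tuple (val a j : nat) | j < n.+1].

Definition linform (R : realType) (n : nat) (l : 'I_n.+1 -> R) : mpoly.mpoly n.+1 R :=
  \sum_j l j *: mpoly.mpolyX R (mpoly.mX j).

Definition powform (R : realType) (n d : nat) (l : 'I_n.+1 -> R) : Hpoly R n d :=
  [ffun a => mpoly.mcoeff (mon_to_multinom a) (linform l ^+ d)].

Definition Vset (R : realType) (n d : nat) : set (Hpoly R n d) :=
  [set f | (exists (l : 'I_n.+1 -> R) (e : R), (e = 1 \/ e = -1) /\ f = e *: powform d l)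
           /\ nrmw (@bw_weight R n d) f = 1].

Arguments Vset : clear implicits.

Definition tidx (r : nat) (n d : 'I_r -> nat) : finType :=
  {dffun forall i : 'I_r, mon (n i) (d i)}.

Definition Htens (R : realType) (r : nat) (n d : 'I_r -> nat) := {ffun tidx n d -> R}.

(* weight making <f1(x)..(x)fr, g1(x)..(x)gr> = prod_i <fi,gi>_BW *)
Definition tens_weight (R : realType) (r : nat) (n d : 'I_r -> nat) (A : tidx n d) : R :=
  \prod_i bw_weight R (A i).

Definition tens (R : realType) (r : nat) (n d : 'I_r -> nat)
  (f : forall i : 'I_r, Hpoly R (n i) (d i)) : Htens R n d :=
  [ffun A : tidx n d => \prod_i f i (A i)].

Definition Xset (R : realType) (r : nat) (n d : 'I_r -> nat) : set (Htens R n d) :=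
  [set F | exists f : forall i : 'I_r, Hpoly R (n i) (d i),
             (forall i, Vset R (n i) (d i) (f i)) /\ F = tens f].

Arguments Xset : clear implicits.

Definition tens_curve (R : realType) (r : nat) (n d : 'I_r -> nat)
  (c : forall i : 'I_r, R -> Hpoly R (n i) (d i)) : R -> Htens R n d :=
  fun t => tens (fun i => c i t).

(* Main.v *)
Require Import Defs.
From HB Require Import structures.
From mathcomp Require Import all_boot all_order all_algebra.
From mathcomp Require Import mpoly.
From mathcomp Require Import all_classical all_reals all_analysis.
From mathcomp Require Import ring lra.

Set Implicit Arguments.
Unset Strict Implicit.
Unset Printing Implicit Defensive.

Import Order.TTheory GRing.Theory Num.Theory.
Local Open Scope classical_set_scope.
Local Open Scope ring_scope.

(* Write Phi(u) for the tensor product of the powers u_i^{d_i}, so that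
   <Phi(u), Phi(v)> = \prod_i <u_i, v_i>^{d_i}. Near a point G0 = e Phi(a) of X
   with |a_i| = 1, every G in X equals <G, G0> e Phi(u) with <u_i, a_i> = 1, and
   u_i is read off G through the pairings of G with the partially polarised
   powers a_i^{d_i - 1} y. Along a curve g through G0 let v_i be the velocity of
   u_i at G0; if g'' is normal to X, the acceleration of u_i vanishes, and
   differentiating <g(s), g(t)> gives |g'|^2 = \sum_i d_i |v_i|^2 and
   |g''|^2 = |g'|^4 + 2 (|g'|^4 - \sum_i d_i |v_i|^4). At unit speed the normal
   part of g'' is g'' + g, so the squared curvature is
   2 - 2 \sum_i p_i^2 / d_i with p_i = d_i |v_i|^2 nonnegative of sum 1; for a
   product of curves, p_i is the squared speed of the i-th factor. *)

(** * Second-order jets of real functions *)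

Section Jets.
Context {R : realType}.
Implicit Types (f g : R -> R) (t : R).

Lemma is_derive_mul f g t a b : is_derive t 1 f a -> is_derive t 1 g b ->
  is_derive t 1 (fun s => f s * g s) (a * g t + f t * b).
Proof.
move=> hf hg; apply: is_derive_eq (is_deriveM hf hg) _.
by rewrite addrC [g t *: a]mulrC.
Qed.

Lemma is_derive_add f g t a b : is_derive t 1 f a -> is_derive t 1 g b ->
  is_derive t 1 (fun s => f s + g s) (a + b).
Proof. by move=> hf hg; exact: (is_deriveD hf hg). Qed.

Lemma is_derive_fsum (I : Type) (s : seq I) (F : I -> R -> R) (dF : I -> R) t :
  (forall i, is_derive t 1 (F i) (dF i)) ->
  is_derive t 1 (fun x => \sum_(i <- s) F i x) (\sum_(i <- s) dF i).
Proof.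
move=> h; elim: s => [|i s IH].
  rewrite big_nil (_ : (fun x => _) = cst 0); last first.
    by apply/funext => x; rewrite big_nil.
  exact: is_derive_cst.
rewrite big_cons (_ : (fun x => _) = F i + (fun x => \sum_(j <- s) F j x)).
  exact: is_deriveD.
by apply/funext => x; rewrite big_cons.
Qed.

Lemma is_derive_inj f t a b : is_derive t 1 f a -> is_derive t 1 f b -> a = b.
Proof. by move=> [_ <-] [_ <-]. Qed.

Lemma is_derive_expn f t a k : is_derive t 1 f a ->
  is_derive t 1 (fun s => f s ^+ k) (k%:R * f t ^+ k.-1 * a).
Proof.
move=> hf; elim: k => [|k IH].
  rewrite !mul0r (_ : (fun s => _) = cst 1) //; exact: is_derive_cst.
have -> : (fun s => f s ^+ k.+1) = (fun s => f s * f s ^+ k).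
  by apply/funext => s; rewrite exprS.
apply: is_derive_eq (is_derive_mul hf IH) _ => /=.
case: k {IH} => [|k] /=; first by rewrite expr0 !mul0r mulr0 addr0 !mul1r mulr1.
by rewrite -[k.+2]addn1 natrD exprS; ring.
Qed.

(** The first derivative is asked for on the whole line, so it is unique as a function and the
    second derivative at [t] is determined by [f]. *)
Definition jet2 f t (x0 x1 x2 : R) := f t = x0 /\
  exists f' : R -> R, [/\ forall s : R, is_derive s 1 f (f' s), f' t = x1 & is_derive t 1 f' x2].

Lemma jet2_inj f t x0 x1 x2 y0 y1 y2 :
  jet2 f t x0 x1 x2 -> jet2 f t y0 y1 y2 -> [/\ x0 = y0, x1 = y1 & x2 = y2].
Proof.
move=> [<- [f' [hf <- h2]]] [<- [g' [hg <- k2]]].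
have e : f' = g' by apply/funext => s; apply: is_derive_inj (hf s) (hg s).
by subst g'; split=> //; apply: is_derive_inj h2 k2.
Qed.

Lemma jet2_eq f t x0 x1 x2 y0 y1 y2 : jet2 f t x0 x1 x2 ->
  x0 = y0 -> x1 = y1 -> x2 = y2 -> jet2 f t y0 y1 y2.
Proof. by move=> h <- <- <-. Qed.

Lemma jet2_cst t k : jet2 (fun=> k) t k 0 0.
Proof.
split=> //; exists (fun=> 0); split=> //; first by move=> s; apply: is_derive_cst.
exact: is_derive_cst.
Qed.

Lemma jet2D f g t x0 x1 x2 y0 y1 y2 : jet2 f t x0 x1 x2 -> jet2 g t y0 y1 y2 ->
  jet2 (fun s => f s + g s) t (x0 + y0) (x1 + y1) (x2 + y2).
Proof.
move=> [<- [f' [hf <- h2]]] [<- [g' [hg <- k2]]]; split=> //.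
exists (fun s => f' s + g' s); split=> //; last exact: is_derive_add.
by move=> s; apply: is_derive_add.
Qed.

Lemma jet2M f g t x0 x1 x2 y0 y1 y2 : jet2 f t x0 x1 x2 -> jet2 g t y0 y1 y2 ->
  jet2 (fun s => f s * g s) t (x0 * y0) (x1 * y0 + x0 * y1)
    (x2 * y0 + 2 * (x1 * y1) + x0 * y2).
Proof.
move=> [<- [f' [hf <- h2]]] [<- [g' [hg <- k2]]]; split=> //.
exists (fun s => f' s * g s + f s * g' s); split=> //.
  by move=> s; apply: is_derive_mul.
apply: is_derive_eq (is_derive_add (is_derive_mul h2 (hg t)) (is_derive_mul (hf t) k2)) _.
ring.
Qed.

Lemma jet2_sum (I : Type) (s : seq I) (F : I -> R -> R) (x0 x1 x2 : I -> R) t :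
  (forall i, jet2 (F i) t (x0 i) (x1 i) (x2 i)) ->
  jet2 (fun x => \sum_(i <- s) F i x) t
    (\sum_(i <- s) x0 i) (\sum_(i <- s) x1 i) (\sum_(i <- s) x2 i).
Proof.
move=> h; elim: s => [|i s IH].
  rewrite !big_nil (_ : (fun x => _) = cst 0); last first.
    by apply/funext => x; rewrite big_nil.
  exact: jet2_cst.
rewrite !big_cons (_ : (fun x => _) = (fun x => F i x + \sum_(j <- s) F j x)).
  exact: jet2D.
by apply/funext => x; rewrite big_cons.
Qed.

(* For [f t = 1], [p] and [q] are the first two derivatives of [log f] at [t]; they add up under products. *)
Definition logjet2 f t (p q : R) := jet2 f t 1 p (q + p ^+ 2).

Lemma jet2_log f t p x2 : jet2 f t 1 p x2 -> logjet2 f t p (x2 - p ^+ 2).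
Proof. by rewrite /logjet2 subrK. Qed.

Lemma logjet2_inj f t p q p' q' :
  logjet2 f t p q -> logjet2 f t p' q' -> p = p' /\ q = q'.
Proof. by move=> h k; have [_ <- /addIr <-] := jet2_inj h k. Qed.

Lemma logjet2M f g t p q p' q' : logjet2 f t p q -> logjet2 g t p' q' ->
  logjet2 (fun s => f s * g s) t (p + p') (q + q').
Proof.
move=> h k; have := jet2M h k.
rewrite /logjet2 !mulr1 !mul1r; congr jet2; ring.
Qed.

Lemma logjet2_prod (I : Type) (s : seq I) (P : pred I) (F : I -> R -> R) (p q : I -> R) t :
  (forall i, logjet2 (F i) t (p i) (q i)) ->
  logjet2 (fun x => \prod_(i <- s | P i) F i x) t
    (\sum_(i <- s | P i) p i) (\sum_(i <- s | P i) q i).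
Proof.
move=> h; elim: s => [|i s IH].
  rewrite !big_nil (_ : (fun x => _) = cst 1); last first.
    by apply/funext => x; rewrite big_nil.
  by rewrite /logjet2 expr0n addr0; apply: jet2_cst.
rewrite !big_cons.
have -> : (fun x => \prod_(j <- i :: s | P j) F j x) =
    (fun x => if P i then F i x * \prod_(j <- s | P j) F j x
              else \prod_(j <- s | P j) F j x).
  by apply/funext => x; rewrite big_cons.
by case: (P i) => //; apply: logjet2M.
Qed.

Lemma logjet2X f t p q k : logjet2 f t p q ->
  logjet2 (fun x => f x ^+ k) t (k%:R * p) (k%:R * q).
Proof.
move=> h; elim: k => [|k IH].
  rewrite !mul0r /logjet2 expr0n addr0 (_ : (fun x => _) = cst 1) //.
  exact: jet2_cst.
have -> : (fun x => f x ^+ k.+1) = (fun x => f x * f x ^+ k).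
  by apply/funext => x; rewrite exprS.
have -> : k.+1%:R * p = p + k%:R * p by rewrite -[k.+1]add1n natrD mulrDl mul1r.
have -> : k.+1%:R * q = q + k%:R * q by rewrite -[k.+1]add1n natrD mulrDl mul1r.
exact: logjet2M.
Qed.

End Jets.

(** * Curves in a weighted inner product space *)

Section InnerProduct.
Context {R : realType} {J : finType} (w : J -> R).
Implicit Types (x y z : {ffun J -> R}) (c : R -> {ffun J -> R}).

Lemma ipwC x y : ipw w x y = ipw w y x.
Proof. by apply: eq_bigr => j _; rewrite mulrAC. Qed.

Lemma ipwDl x y z : ipw w (x + y) z = ipw w x z + ipw w y z.
Proof. by rewrite -big_split; apply: eq_bigr => j _; rewrite ffunE mulrDr mulrDl. Qed.

Lemma ipwZl k x z : ipw w (k *: x) z = k * ipw w x z.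
Proof. by rewrite mulr_sumr; apply: eq_bigr => j _; rewrite ffunE -[k *: _]/(k * _); ring. Qed.

Lemma ipwDr x y z : ipw w z (x + y) = ipw w z x + ipw w z y.
Proof. by rewrite !(ipwC z) ipwDl. Qed.

Lemma ipwZr k x z : ipw w z (k *: x) = k * ipw w z x.
Proof. by rewrite !(ipwC z) ipwZl. Qed.

Lemma ipwNl x z : ipw w (- x) z = - ipw w x z.
Proof. by rewrite -scaleN1r ipwZl mulN1r. Qed.

Lemma ipwNr x z : ipw w z (- x) = - ipw w z x.
Proof. by rewrite !(ipwC z) ipwNl. Qed.

Lemma ipw0r z : ipw w z 0 = 0.
Proof. by rewrite /ipw big1 // => j _; rewrite ffunE mulr0. Qed.

Lemma ipw_sumr (I : Type) (s : seq I) (F : I -> {ffun J -> R}) z :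
  ipw w z (\sum_(i <- s) F i) = \sum_(i <- s) ipw w z (F i).
Proof.
elim: s => [|i s IH]; first by rewrite !big_nil ipw0r.
by rewrite !big_cons ipwDr IH.
Qed.

Hypothesis w_gt0 : forall j, 0 < w j.

Lemma ipw_term_ge0 x j : 0 <= w j * x j * x j.
Proof. by rewrite -mulrA -expr2 mulr_ge0 ?sqr_ge0 // ltW. Qed.

Lemma ipw_ge0 x : 0 <= ipw w x x.
Proof. by apply: sumr_ge0 => j _; apply: ipw_term_ge0. Qed.

Lemma ipw_eq0 x : ipw w x x = 0 -> x = 0.
Proof.
move=> /eqP; rewrite psumr_eq0; last by move=> j _; apply: ipw_term_ge0.
move=> /allP h; apply/ffunP => j; rewrite ffunE; apply/eqP.
by have := h j (mem_index_enum _); rewrite -mulrA mulf_eq0 gt_eqF //= -expr2 sqrf_eq0.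
Qed.

Lemma nrmw1 x : (nrmw w x = 1) <-> (ipw w x x = 1).
Proof.
rewrite /nrmw; split=> [h|->]; last by rewrite sqrtr1.
by rewrite -[LHS]sqr_sqrtr ?ipw_ge0 // h expr1n.
Qed.

Lemma is_derive_coord c t j : curve_derivable c t ->
  is_derive t 1 (fun s => c s j) (dcurve c t j).
Proof. by move=> h; rewrite ffunE derive1E; apply/derivableP/h. Qed.

Lemma is_derive_ipw c t z : curve_derivable c t ->
  is_derive t 1 (fun s => ipw w (c s) z) (ipw w (dcurve c t) z).
Proof.
move=> h; apply: is_derive_fsum => j.
apply: is_derive_eq (is_derive_mul (is_derive_mul (is_derive_cst (w j) t 1)
  (is_derive_coord j h)) (is_derive_cst (z j) t 1)) _.
by rewrite mul0r add0r mulr0 addr0.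
Qed.

Definition twice_derivable c :=
  (forall t, curve_derivable c t) /\ (forall t, curve_derivable (dcurve c) t).

Lemma jet2_ipw c t z : twice_derivable c ->
  jet2 (fun s => ipw w (c s) z) t
    (ipw w (c t) z) (ipw w (dcurve c t) z) (ipw w (dcurve (dcurve c) t) z).
Proof.
move=> [h1 h2]; split=> //; exists (fun s => ipw w (dcurve c s) z); split=> //.
  by move=> s; apply: is_derive_ipw.
exact: is_derive_ipw.
Qed.

Lemma ipw_dcurve_cst c t z k : (forall s, ipw w (c s) z = k) ->
  curve_derivable c t -> ipw w (dcurve c t) z = 0.
Proof.
move=> e h; apply: is_derive_inj (is_derive_ipw z h) _.
rewrite (_ : (fun s => _) = cst k); last by apply/funext.
exact: is_derive_cst.
Qed.

Lemma is_derive_ipw2 c b t : curve_derivable c t -> curve_derivable b t ->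
  is_derive t 1 (fun s => ipw w (c s) (b s))
    (ipw w (dcurve c t) (b t) + ipw w (c t) (dcurve b t)).
Proof.
move=> hc hb.
have hj j : is_derive t 1 (fun s => w j * c s j * b s j)
    (w j * dcurve c t j * b t j + w j * c t j * dcurve b t j).
  apply: is_derive_eq (is_derive_mul (is_derive_mul (is_derive_cst (w j) t 1)
    (is_derive_coord j hc)) (is_derive_coord j hb)) _.
  by rewrite mul0r add0r.
apply: is_derive_eq (is_derive_fsum (index_enum J) hj) _.
by rewrite big_split.
Qed.

Lemma ipw_dcurve_sphere c t k : (forall s, ipw w (c s) (c s) = k) ->
  curve_derivable c t -> ipw w (dcurve c t) (c t) = 0.
Proof.
move=> e h; have : 2 * ipw w (dcurve c t) (c t) = 0.
  apply: is_derive_inj (_ : is_derive t 1 (fun s => ipw w (c s) (c s)) _) _; last first.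
    rewrite (_ : (fun s => _) = cst k); last by apply/funext.
    exact: is_derive_cst.
  apply: is_derive_eq (is_derive_ipw2 h h) _.
  by rewrite (ipwC (c t)) mulr_natl.
by move=> /eqP; rewrite mulf_eq0 pnatr_eq0 /= => /eqP.
Qed.

Lemma ipw_ddcurve_sphere c t k : (forall s, ipw w (c s) (c s) = k) ->
  twice_derivable c ->
  ipw w (dcurve (dcurve c) t) (c t) = - ipw w (dcurve c t) (dcurve c t).
Proof.
move=> e [h1 h2]; apply/eqP; rewrite -addr_eq0; apply/eqP.
apply: is_derive_inj (is_derive_ipw2 (h2 t) (h1 t)) _.
rewrite (_ : (fun s => _) = cst 0); first exact: is_derive_cst.
by apply/funext => s; apply: ipw_dcurve_sphere e (h1 s).
Qed.

(** Differentiating |c|^2 = 1 twice gives <c'', c> = -1, and c'' is orthogonal to every tangent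
    vector. So c'' + c is normal while c is orthogonal to the normal space: c'' + c is the
    projection, of squared norm |c''|^2 - 2 + 1. *)
Lemma curvature_geodesic M c t : (forall G, M G -> ipw w G G = 1) ->
  is_geodesic w M c -> arc_length w c ->
  curvature w M c t =
    Num.sqrt (ipw w (dcurve (dcurve c) t) (dcurve (dcurve c) t) - 1).
Proof.
move=> M1 [cM [c1 [c2 cT]]] al.
have hcc s : ipw w (c s) (c s) = 1 by apply: M1.
have e1 : ipw w (dcurve c t) (dcurve c t) = 1 by apply/nrmw1.
have e2 := ipw_ddcurve_sphere t hcc (conj c1 c2); rewrite e1 in e2.
rewrite /curvature; set x := dcurve (dcurve c) t in e2 *.
have -> : orth_proj w (Defs.normal_space w M (c t)) x = x + c t; last first.
  by rewrite /nrmw; congr Num.sqrt; rewrite ipwDl !ipwDr (ipwC (c t)) e2 hcc; ring.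
have tG v : tangent_space M (c t) v -> ipw w (c t) v = 0.
  move=> [b [bM [<- [b1 ->]]]]; rewrite ipwC.
  by apply: ipw_dcurve_sphere b1 => s; apply: M1.
apply: xget_unique; first split; first split.
- by rewrite ipwDl e2 hcc addNr.
- by move=> v vT; rewrite ipwDl cT // tG // addr0.
- by move=> s [sG _]; rewrite opprD addNKr ipwNl ipwC sG oppr0.
(* [xget] may return any candidate, so uniqueness is needed: the difference [u] of two candidates is
   itself normal, and pairing it with itself gives 0. *)
move=> p [[pG pT] pS]; apply/eqP; rewrite -subr_eq0; apply/eqP/ipw_eq0.
set u := p - (x + c t).
have uS : Defs.normal_space w M (c t) u.
  split; first by rewrite ipwDl pG ipwNl ipwDl e2 hcc addNr oppr0 addr0.
  by move=> v vT; rewrite ipwDl pT // ipwNl ipwDl cT // tG // addr0 oppr0 addr0.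
have {1}-> : u = - (x - p) - c t by rewrite /u; apply/ffunP => j; rewrite !ffunE; ring.
by rewrite ipwDl !ipwNl pS // oppr0 add0r ipwC (proj1 uS) oppr0.
Qed.

End InnerProduct.

(** * Manifolds of products of powers *)

Lemma dcurveZ (R : realType) (J : finType) (c : R -> {ffun J -> R}) (k t : R) :
  curve_derivable c t ->
  curve_derivable (fun s => k *: c s) t /\
  dcurve (fun s => k *: c s) t = k *: dcurve c t.
Proof.
move=> h.
have hj j : is_derive t 1 (fun s => (k *: c s) j) (k * dcurve c t j).
  have -> : (fun s => (k *: c s) j) = (fun s => k * c s j).
    by apply/funext => s; rewrite ffunE.
  apply: is_derive_eq (is_derive_mul (is_derive_cst k t 1) (is_derive_coord j h)) _.
  by rewrite mul0r add0r.
split; first by move=> j; case: (hj j).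
by apply/ffunP => j; rewrite [LHS]ffunE [RHS]ffunE derive1E; case: (hj j).
Qed.

Definition dot (R : realType) m (x y : 'I_m -> R) : R := \sum_j x j * y j.

Section Dot.
Context {R : realType} {m : nat}.
Implicit Types x y z : 'I_m -> R.

Lemma dotC x y : dot x y = dot y x.
Proof. by apply: eq_bigr => j _; rewrite mulrC. Qed.

Lemma dot_comb x y z (p q : R) :
  dot x (fun j => p * y j + q * z j) = p * dot x y + q * dot x z.
Proof. by rewrite /dot !mulr_sumr -big_split; apply: eq_bigr => j _ /=; ring. Qed.

Lemma dot_combl x y z (p q : R) :
  dot (fun j => p * y j + q * z j) x = p * dot y x + q * dot z x.
Proof. by rewrite dotC dot_comb !(dotC x). Qed.

Lemma dotZ x y (p : R) : dot x (fun j => p * y j) = p * dot x y.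
Proof. by rewrite /dot mulr_sumr; apply: eq_bigr => j _; ring. Qed.

Lemma dot_ge0 x : 0 <= dot x x.
Proof. by apply: sumr_ge0 => j _; rewrite -expr2 sqr_ge0. Qed.

Lemma dot_eq0 x : dot x x = 0 -> x = fun=> 0.
Proof.
move=> /eqP; rewrite psumr_eq0; last by move=> j _; rewrite -expr2 sqr_ge0.
move=> /allP h; apply/funext => j; apply/eqP.
by have := h j (mem_index_enum _); rewrite /= -expr2 sqrf_eq0.
Qed.

End Dot.

Section PowerManifold.
Context {R : realType} {I J : finType}.
Variables (n d : I -> nat) (w : J -> R).
Local Notation fam := (forall i : I, 'I_(n i).+1 -> R).
Variables (Phi : fam -> {ffun J -> R}) (M : set {ffun J -> R}).

(* Common axiomatisation of the single factors V (one index) and of the product X. *)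
Record power_manifold : Prop := PowerManifold {
  d_gt0 : forall i, (0 < d i)%N;
  weight_gt0 : forall j, 0 < w j;
  power_ipw : forall u v, ipw w (Phi u) (Phi v) = \prod_i dot (u i) (v i) ^+ d i;
  power_derivable : forall (c : R -> fam) t,
    (forall i j, derivable (fun s => c s i j) t 1) ->
    curve_derivable (fun s => Phi (c s)) t;
  manifoldP : forall G, M G <-> exists (e : R) (a : fam),
    [/\ e ^+ 2 = 1, forall i, dot (a i) (a i) = 1 & G = e *: Phi a] }.

Hypothesis PM : power_manifold.

(** Homogeneity follows from the pairings alone: the difference of the two sides is a combination of
    values of [Phi] orthogonal to every value of [Phi]. *)
Lemma power_scale (k : I -> R) (u : fam) :
  Phi (fun i j => k i * u i j) = (\prod_i k i ^+ d i) *: Phi u.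
Proof.
set p := \prod_i _; apply/eqP; rewrite -subr_eq0; apply/eqP.
apply: (ipw_eq0 (weight_gt0 PM)).
have K v : ipw w (Phi v) (Phi (fun i j => k i * u i j)) = p * ipw w (Phi v) (Phi u).
  rewrite !(power_ipw PM) -big_split; apply: eq_bigr => i _ /=.
  by rewrite -exprMn dotZ.
rewrite ipwDl !ipwDr !ipwNl !ipwNr !ipwZl !ipwZr K ipwC K; ring.
Qed.

Lemma manifold_sphere G : M G -> ipw w G G = 1.
Proof.
move=> /(manifoldP PM) [e [a [e2 a1 ->]]].
rewrite ipwZl ipwZr mulrA -expr2 e2 mul1r (power_ipw PM) big1 // => i _.
by rewrite a1 expr1n.
Qed.

(** Factor [i] runs along the circle spanned by [a i] and [y i]. If [a] consists of unit vectors and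
    [y i] is a unit vector orthogonal to [a i], all factors keep length 1 and the power stays in [M]
    up to sign. *)
Definition rot (a y : fam) (i : I) (s : R) : fam :=
  fun k j => if k == i then cos s * a k j + sin s * y k j else a k j.

Lemma rot0 a y i : rot a y i 0 = a.
Proof.
apply/functional_extensionality_dep => k; apply/funext => j; rewrite /rot.
by case: eqP => // _; rewrite cos0 sin0 mul1r mul0r addr0.
Qed.

Lemma rot_derivable a y i s :
  curve_derivable (fun s => Phi (rot a y i s)) s.
Proof.
apply: (power_derivable PM) => k j; rewrite /rot; case: eqP => _; last exact: derivable_cst.
by case: (is_derive_add (is_derive_mul (is_derive_cos s) (is_derive_cst (a k j) s 1))
  (is_derive_mul (is_derive_sin s) (is_derive_cst (y k j) s 1))).
Qed.

(* [Phi a] with one of its [d i] factors [a i] replaced by [y i]; see [polar_ipw]. *)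
Definition polar (a y : fam) (i : I) : {ffun J -> R} :=
  (d i)%:R^-1 *: dcurve (fun s => Phi (rot a y i s)) 0.

(** Along the circle the pairing with [Phi l] is a constant times a [d i]-th power; its derivative
    at 0 has a factor [d i], which the definition of [polar] cancels. *)
Lemma polar_ipw l a y i : ipw w (Phi l) (polar a y i) =
  (\prod_(k | k != i) dot (l k) (a k) ^+ d k) *
  dot (l i) (a i) ^+ (d i).-1 * dot (l i) (y i).
Proof.
set p := \prod_(k | _) _.
have hf : (fun s => ipw w (Phi (rot a y i s)) (Phi l)) =
    (fun s => p * (cos s * dot (l i) (a i) + sin s * dot (l i) (y i)) ^+ d i).
  apply/funext => s; rewrite ipwC (power_ipw PM) (bigD1 i) //= mulrC /rot.
  congr (_ * _); last by rewrite eqxx dot_comb.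
  by apply: eq_bigr => k /negbTE ->.
have hd := is_derive_ipw w (Phi l) (@rot_derivable a y i 0).
have hc := is_derive_add (is_derive_mul (is_derive_cos (0 : R)) (is_derive_cst (dot (l i) (a i)) (0 : R) 1))
  (is_derive_mul (is_derive_sin (0 : R)) (is_derive_cst (dot (l i) (y i)) (0 : R) 1)).
have hp := is_derive_mul (is_derive_cst p (0 : R) 1) (is_derive_expn (d i) hc).
rewrite hf in hd; have := is_derive_inj hd hp.
rewrite cos0 sin0 !mulr0 !mul0r oppr0 !mul0r !mul1r !addr0 !add0r /= => e.
rewrite ipwC ipwZl e.
have : (d i)%:R != 0 :> R by rewrite pnatr_eq0 -lt0n (d_gt0 PM).
by move=> ?; field.
Qed.

Lemma polar_tangent (e : R) a y i : e ^+ 2 = 1 -> (forall k, dot (a k) (a k) = 1) ->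
  dot (a i) (y i) = 0 -> dot (y i) (y i) = 1 ->
  tangent_space M (e *: Phi a) ((e * (d i)%:R) *: polar a y i).
Proof.
move=> e2 a1 ay y1.
have [h1 h2] := dcurveZ e (@rot_derivable a y i 0).
exists (fun s => e *: Phi (rot a y i s)); split.
  move=> s; apply/(manifoldP PM); exists e, (rot a y i s); split=> // k.
  rewrite /rot; case: eqP => [->|_] //.
  rewrite dot_comb !dot_combl a1 (dotC (y i) (a i)) ay y1.
  by rewrite !mulr1 !mulr0 addr0 add0r -!expr2 cos2Dsin2.
split; first by rewrite rot0.
split=> //; rewrite h2 scalerA -mulrA divff ?mulr1 //.
by rewrite pnatr_eq0 -lt0n (d_gt0 PM).
Qed.

(** * Linear coordinates at a base point and the chart around it *)

Section BasePoint.
Variables (e : R) (a : fam).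
Local Arguments a : clear implicits.
Hypotheses (e2 : e ^+ 2 = 1) (a1 : forall i, dot (a i) (a i) = 1).
(** Both are linear in [G], so along a curve they are differentiated by pairing with the derivatives
    of the curve. In the chart, [H G] is the height over the base point and [X y i G] is [H G] times
    the coordinate of [u i] along [y i]. *)
Local Notation H G := (ipw w G (e *: Phi a)).
Local Notation X y i G := (ipw w G (e *: polar a y i)).

Lemma polar_base y i : X y i (e *: Phi a) = dot (a i) (y i).
Proof.
rewrite ipwZl (ipwZr w e) mulrA -expr2 e2 mul1r polar_ipw a1 expr1n mulr1.
by rewrite big1 ?mul1r // => k _; rewrite a1 expr1n.
Qed.

Lemma polar_a G i : M G -> X a i G = H G.
Proof.
move=> /(manifoldP PM) [f [l [_ _ ->]]]; rewrite !ipwZl !(ipwZr w e) polar_ipw.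
congr (_ * (_ * _)); rewrite (power_ipw PM) [RHS](bigD1 i) //= -mulrA -exprSr.
by rewrite prednK ?(d_gt0 PM) // mulrC.
Qed.

(** Indexed by a natural number, so that one [j] serves factors of different dimensions; it is zero
    in a factor with at most [j] coordinates. *)
Definition unit_vector (j : nat) : fam := fun i k => (k == j :> nat)%:R.

Arguments unit_vector : clear implicits.

Lemma dot_unit_vector i (x : 'I_(n i).+1 -> R) (j : 'I_(n i).+1) : dot x (unit_vector j i) = x j.
Proof.
rewrite /dot (bigD1 j) //= /unit_vector eqxx mulr1 big1 ?addr0 // => k kj.
by rewrite (inj_eq val_inj) (negbTE kj) mulr0.
Qed.

Lemma polar_linear G y i : M G ->
  X y i G = \sum_(j < (n i).+1) y i j * X (unit_vector j) i G.
Proof.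
move=> /(manifoldP PM) [f [l [_ _ ->]]]; rewrite ipwZl (ipwZr w e) polar_ipw.
rewrite {2}/dot !mulr_sumr; apply: eq_bigr => j _.
by rewrite ipwZl (ipwZr w e) polar_ipw dot_unit_vector; ring.
Qed.

(* The chart in division-free form: it holds on all of [M], so it can be
   differentiated along any curve in [M] without localising. *)
Lemma power_relation G u : M G ->
  H G ^+ (\sum_i d i) * ipw w G (e *: Phi u) = H G * \prod_i X u i G ^+ d i.
Proof.
move=> /(manifoldP PM) [f [l [_ _ ->]]].
set b := \prod_i dot (l i) (a i) ^+ d i.
have HE : H (f *: Phi l) = f * e * b by rewrite ipwZl (ipwZr w e) (power_ipw PM) -/b; ring.
(* [B i] is [b] with one factor [dot (l i) (a i)] removed, which avoids dividing by that pairing. *)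
pose B i := (\prod_(k | k != i) dot (l k) (a k) ^+ d k) * dot (l i) (a i) ^+ (d i).-1.
have XE i : X u i (f *: Phi l) = f * e * (B i * dot (l i) (u i)).
  by rewrite ipwZl (ipwZr w e) polar_ipw -/(B i); ring.
have BE i : B i * dot (l i) (a i) = b.
  by rewrite /B /b [RHS](bigD1 i) //= -mulrA -exprSr prednK ?(d_gt0 PM) // mulrC.
have BB : (\prod_i B i ^+ d i) * b = b ^+ (\sum_i d i).
  rewrite -big_split /= expr_sum; apply: eq_bigr => i _.
  by rewrite -exprMn BE.
have -> : \prod_i X u i (f *: Phi l) ^+ d i =
    \prod_i ((f * e) ^+ d i * (B i ^+ d i * dot (l i) (u i) ^+ d i)).
  by apply: eq_bigr => i _; rewrite XE exprMn; congr (_ * _); rewrite exprMn.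
rewrite !big_split /= -expr_sum HE ipwZl (ipwZr w e) (power_ipw PM) exprMn -BB; ring.
Qed.

(** If [H G] is nonzero, so is each [dot (l i) (a i)], since it occurs in [H G] with exponent
    [d i > 0]. Dividing [l i] by it normalises [u i], and homogeneity collects the scalars into
    [H G]. *)
Lemma chart G : M G -> H G != 0 -> exists u : fam,
  [/\ forall i, dot (a i) (u i) = 1, G = (H G * e) *: Phi u &
      forall y i, X y i G = H G * dot (y i) (u i)].
Proof.
move=> /(manifoldP PM) [f [l [_ _ ->]]] H0.
have HE : H (f *: Phi l) = f * e * \prod_i dot (l i) (a i) ^+ d i.
  by rewrite ipwZl (ipwZr w e) (power_ipw PM); ring.
have b0 i : dot (l i) (a i) != 0.
  apply: contra_neq H0 => b0; rewrite HE (bigD1 i) //= b0 expr0n.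
  by rewrite eqn0Ngt (d_gt0 PM) /= mul0r mulr0.
exists (fun i j => (dot (l i) (a i))^-1 * l i j); split.
- by move=> i; rewrite dotZ (dotC (a i)) mulVf.
- rewrite power_scale scalerA HE; congr (_ *: _).
  set P := (X in f * e * X); set Q := \prod_i _.
  have PQ : P * Q = 1.
    by rewrite /P /Q -big_split big1 // => i _; rewrite /= -exprMn mulfV // expr1n.
  have -> : f * e * P * e * Q = f * e ^+ 2 * (P * Q) by ring.
  by rewrite e2 PQ !mulr1.
move=> y i; rewrite HE ipwZl (ipwZr w e) polar_ipw dotZ (dotC (y i)) [in RHS](bigD1 i) //=.
by rewrite -[in RHS](prednK (d_gt0 PM i)) exprS; field.
Qed.

(** * First and second derivatives of a curve in the chart *)

Section Curve.
Variables (g : R -> {ffun J -> R}) (t0 : R).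
Hypotheses (gM : forall t, M (g t)) (g2 : twice_derivable g) (g0 : g t0 = e *: Phi a).
Local Notation g' := (dcurve g t0).
Local Notation g'' := (dcurve (dcurve g) t0).

Definition velocity : fam := fun i j => X (unit_vector j) i g'.
(** As [H g' = 0], this is [H g''] times [a i] plus the acceleration of the chart coordinate
    [u i]. *)
Definition acceleration : fam := fun i j => X (unit_vector j) i g''.
Local Arguments velocity : clear implicits.
Local Arguments acceleration : clear implicits.

Lemma polar_linear_sub G y i :
  ipw w G (e *: polar a y i - \sum_(j < (n i).+1) y i j *: (e *: polar a (unit_vector j) i)) =
  X y i G - \sum_(j < (n i).+1) y i j * X (unit_vector j) i G.
Proof.
rewrite ipwDr ipwNr ipw_sumr; congr (_ - _).
by apply: eq_bigr => j _; rewrite (ipwZr w (y i j)).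
Qed.

(** By [polar_linear], the curve pairs to zero with one fixed vector, hence so does its derivative;
    [accelerationE] repeats this once more. *)
Lemma velocityE y i : X y i g' = dot (y i) (velocity i).
Proof.
apply/eqP; rewrite -subr_eq0 -polar_linear_sub; apply/eqP.
apply: ipw_dcurve_cst (proj1 g2 t0) => s.
by rewrite polar_linear_sub polar_linear ?subrr.
Qed.

Lemma accelerationE y i : X y i g'' = dot (y i) (acceleration i).
Proof.
apply/eqP; rewrite -subr_eq0 -polar_linear_sub; apply/eqP.
apply: ipw_dcurve_cst (proj2 g2 t0) => s.
apply: ipw_dcurve_cst (proj1 g2 s) => r.
by rewrite polar_linear_sub polar_linear ?subrr.
Qed.

Lemma height_base : H (g t0) = 1.
Proof. by rewrite -g0 manifold_sphere. Qed.

Lemma height_velocity : H g' = 0.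
Proof.
rewrite -g0; apply: ipw_dcurve_sphere (proj1 g2 t0) => s.
exact: manifold_sphere (gM s).
Qed.

Lemma height_acceleration : H g'' = - ipw w g' g'.
Proof.
rewrite -g0; apply: ipw_ddcurve_sphere g2 => s.
exact: manifold_sphere (gM s).
Qed.

Lemma velocity_base i : dot (a i) (velocity i) = 0.
Proof.
rewrite -velocityE; have hs s : ipw w (g s) (e *: polar a a i - e *: Phi a) = 0.
  by rewrite ipwDr ipwNr polar_a ?subrr.
have := ipw_dcurve_cst hs (proj1 g2 t0).
by rewrite ipwDr ipwNr height_velocity subr0.
Qed.

Lemma acceleration_base i : dot (a i) (acceleration i) = H g''.
Proof.
rewrite -accelerationE; have hs s : ipw w (g s) (e *: polar a a i - e *: Phi a) = 0.
  by rewrite ipwDr ipwNr polar_a ?subrr.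
have := ipw_dcurve_cst (fun s => ipw_dcurve_cst hs (proj1 g2 s)) (proj2 g2 t0).
by rewrite ipwDr ipwNr => /eqP; rewrite subr_eq0 => /eqP.
Qed.

(** Normality of [g''] is assumed in the polarised directions only; [normal_acceleration] deduces it
    for all tangent vectors, which is how products of curves are shown to be geodesics. *)
Hypothesis gN : forall y i, dot (a i) (y i) = 0 -> X y i g'' = 0.

Lemma acceleration_chart u i : dot (a i) (u i) = 1 -> X u i g'' = H g''.
Proof.
(* The difference [u - a] is orthogonal to [a i], so [gN] kills it and only the contribution of [a]
   remains. *)
move=> u1; have := gN (y := fun k j => 1 * u k j + -1 * a k j) (i := i).
rewrite !accelerationE dot_comb dot_combl u1 a1 acceleration_base => h.
by apply/eqP; rewrite -subr_eq0 -[V in V - _]mul1r -mulN1r h //; ring.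
Qed.

(** All pairings in [power_relation] equal 1 at [t0], so both sides have log jets that add up factor
    by factor; comparing them gives the two formulas. *)
Lemma chart_expansion u : (forall i, dot (a i) (u i) = 1) ->
  ipw w g' (e *: Phi u) = \sum_i (d i)%:R * dot (u i) (velocity i) /\
  ipw w g'' (e *: Phi u) = H g'' + (\sum_i (d i)%:R * dot (u i) (velocity i)) ^+ 2
    - \sum_i (d i)%:R * dot (u i) (velocity i) ^+ 2.
Proof.
move=> u1.
have jH : logjet2 (fun s => H (g s)) t0 0 (H g'').
  have := jet2_ipw w t0 (e *: Phi a) g2; rewrite height_base height_velocity.
  by move=> /jet2_log; rewrite expr0n subr0.
have jX i : logjet2 (fun s => X u i (g s)) t0
    (dot (u i) (velocity i)) (H g'' - dot (u i) (velocity i) ^+ 2).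
  have := jet2_ipw w t0 (e *: polar a u i) g2.
  by rewrite velocityE acceleration_chart // g0 polar_base u1 => /jet2_log.
have jP := jet2_ipw w t0 (e *: Phi u) g2.
rewrite {1}g0 ipwZl ipwZr (power_ipw PM) mulrA -expr2 e2 mul1r big1 in jP; last first.
  by move=> i _; rewrite u1 expr1n.
have jL := logjet2M (logjet2X (\sum_i d i) jH) (jet2_log jP).
have jR := logjet2M jH (logjet2_prod (index_enum I) xpredT (fun i => logjet2X (d i) (jX i))).
have eLR : (fun s => H (g s) ^+ (\sum_i d i) * ipw w (g s) (e *: Phi u)) =
    (fun s => H (g s) * \prod_i X u i (g s) ^+ d i).
  by apply/funext => s; rewrite power_relation.
rewrite eLR in jL; have [] := logjet2_inj jL jR.
rewrite mulr0 !add0r => -> e'; split=> //; apply/eqP; rewrite -subr_eq0.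
set S := \sum_i (d i)%:R * dot (u i) (velocity i) in e' *.
(* The term [(\sum_i d i)%:R * H g''] arises on both sides and cancels. *)
have hs : \sum_i (d i)%:R * (H g'' - dot (u i) (velocity i) ^+ 2) =
    (\sum_i d i)%:R * H g'' - \sum_i (d i)%:R * dot (u i) (velocity i) ^+ 2.
  by rewrite natr_sum mulr_suml -sumrB; apply: eq_bigr => i _; rewrite mulrBr.
rewrite hs in e'; apply/eqP; move: e'; set Q := \sum_i (d i)%:R * _ ^+ 2; lra.
Qed.

(** In the chart this is [H G ^+ 2] times the quadratic part of [chart_expansion]; written with
    pairings it is a polynomial in [G]. *)
Definition quad G := (\sum_i (d i)%:R * X velocity i G) ^+ 2
  - \sum_i (d i)%:R * X velocity i G ^+ 2.

(* The factor [H G] makes these identities hold also where the chart is undefined, [H G = 0]. *)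
Lemma first_order G : M G ->
  H G * ipw w g' G = H G * \sum_i (d i)%:R * X velocity i G.
Proof.
move=> MG; have [->|H0] := eqVneq (H G) 0; first by rewrite !mul0r.
have [u [u1 GE XE]] := chart MG H0; congr (_ * _).
have [e' _] := chart_expansion u1.
rewrite {1}GE -scalerA ipwZr e' mulr_sumr; apply: eq_bigr => i _.
by rewrite XE (dotC (u i)); ring.
Qed.

Lemma second_order G : M G ->
  H G ^+ 2 * ipw w g'' G = H G ^+ 3 * H g'' + H G * quad G.
Proof.
move=> MG; have [->|H0] := eqVneq (H G) 0; first by rewrite !expr0n !mul0r addr0.
have [u [u1 GE XE]] := chart MG H0.
have [_ e'] := chart_expansion u1.
have -> : quad G = H G ^+ 2 * ((\sum_i (d i)%:R * dot (u i) (velocity i)) ^+ 2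
    - \sum_i (d i)%:R * dot (u i) (velocity i) ^+ 2).
  rewrite mulrBr -exprMn !mulr_sumr; congr (_ ^+ 2 - _).
    by apply: eq_bigr => i _; rewrite XE (dotC (u i)); ring.
  by apply: eq_bigr => i _; rewrite XE (dotC (u i)); ring.
have -> : ipw w g'' G = H G * ipw w g'' (e *: Phi u).
  by rewrite [in LHS]GE -scalerA ipwZr.
by rewrite e'; ring.
Qed.

(** [second_order] along a curve, spelt with products so that the product rules apply to it
    literally. *)
Lemma cubic_identity k (b : R -> {ffun J -> R}) : H g'' = k -> (forall s, M (b s)) ->
  (fun s => H (b s) * H (b s) * ipw w (b s) g'') =
  (fun s => H (b s) * H (b s) * H (b s) * k + H (b s) *
    ((\sum_i (d i)%:R * X velocity i (b s)) * (\sum_i (d i)%:R * X velocity i (b s))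
     + (-1) * (\sum_i (d i)%:R * (X velocity i (b s) * X velocity i (b s))))).
Proof.
move=> <- bM; apply/funext => s; rewrite (ipwC w (b s) g'') -expr2 second_order // /quad.
by rewrite mulN1r -exprSr -expr2.
Qed.

(** Differentiate [first_order] along [g] itself at [t0], where [H] is 1 with derivative 0. *)
Lemma speedE : ipw w g' g' = \sum_i (d i)%:R * dot (velocity i) (velocity i).
Proof.
pose L s := H (g s) * \sum_i (d i)%:R * X velocity i (g s).
have dH := is_derive_ipw w (e *: Phi a) (proj1 g2 t0).
have d1 := is_derive_mul dH (is_derive_ipw w g' (proj1 g2 t0)).
have dX := is_derive_fsum (index_enum I) (fun i => is_derive_mul
  (is_derive_cst ((d i)%:R : R) t0 1) (is_derive_ipw w (e *: polar a velocity i) (proj1 g2 t0))).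
have d2 := is_derive_mul dH dX.
have e' : (fun s => H (g s) * ipw w (g s) g') = L.
  by apply/funext => s; rewrite (ipwC w (g s) g') first_order.
rewrite e' in d1; have := is_derive_inj d1 d2.
rewrite height_velocity height_base !mul0r !add0r !mul1r => ->.
by apply: eq_bigr => i _; rewrite mul0r add0r velocityE.
Qed.

(** Compare second derivatives at [t0] in [cubic_identity] along [g]. Each [X velocity i] vanishes
    at [t0], so the quadratic part contributes only squares of first derivatives, and [g''] drops
    out of it. *)
Lemma accelE : let S := \sum_i (d i)%:R * dot (velocity i) (velocity i) in
  ipw w g'' g'' = S ^+ 2 + 2 * (S ^+ 2
    - \sum_i (d i)%:R * dot (velocity i) (velocity i) ^+ 2).
Proof.
move=> S.
have hH : H g'' = - S by rewrite height_acceleration speedE.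
have jH := jet2_ipw w t0 (e *: Phi a) g2.
rewrite height_base height_velocity hH in jH.
have jA := jet2_ipw w t0 g'' g2.
rewrite (ipwC w (g t0)) g0 hH in jA.
have jX i := jet2_ipw w t0 (e *: polar a velocity i) g2.
have X0 i : X velocity i (g t0) = 0 by rewrite g0 polar_base velocity_base.
have jS : jet2 (fun s => \sum_i (d i)%:R * X velocity i (g s)) t0 0 S
    (\sum_i (d i)%:R * X velocity i g'').
  apply: jet2_eq (jet2_sum (index_enum I) (fun i => jet2M (jet2_cst t0 (d i)%:R) (jX i))) _ _ _.
  - by rewrite big1 // => i _; rewrite X0 mulr0.
  - by apply: eq_bigr => i _; rewrite velocityE mul0r add0r.
  - by apply: eq_bigr => i _; ring.
have jQ : jet2 (fun s => \sum_i (d i)%:R * (X velocity i (g s) * X velocity i (g s))) t0 0 0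
    (2 * \sum_i (d i)%:R * dot (velocity i) (velocity i) ^+ 2).
  apply: jet2_eq (jet2_sum (index_enum I) (fun i =>
    jet2M (jet2_cst t0 (d i)%:R) (jet2M (jX i) (jX i)))) _ _ _.
  - by rewrite big1 // => i _; rewrite X0 !mulr0.
  - by rewrite big1 // => i _; rewrite X0; ring.
  - by rewrite mulr_sumr; apply: eq_bigr => i _; rewrite X0 velocityE; ring.
have j1 := jet2M (jet2M jH jH) jA.
have j2 := jet2D (jet2M (jet2M (jet2M jH jH) jH) (jet2_cst t0 (- S)))
  (jet2M jH (jet2D (jet2M jS jS) (jet2M (jet2_cst t0 (-1)) jQ))).
rewrite (cubic_identity hH gM) in j1.
have [_ _] := jet2_inj j1 j2; set Q := \sum_i _ * _ ^+ 2 => e'.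
by apply/eqP; rewrite -subr_eq0; move/eqP: e'; rewrite -subr_eq0 => /eqP <-; apply/eqP; ring.
Qed.

(** Differentiate [cubic_identity] once along a curve [b] with velocity [v]: [H] is stationary and
    the quadratic part vanishes to second order, so only <g'', v> = 0 is left. *)
Lemma normal_acceleration v : tangent_space M (g t0) v -> ipw w g'' v = 0.
Proof.
move=> [b [bM [b0 [b1 ->]]]].
have dH := is_derive_ipw w (e *: Phi a) b1.
have dA := is_derive_ipw w g'' b1.
have dX i := is_derive_ipw w (e *: polar a velocity i) b1.
have X0 i : X velocity i (b 0) = 0 by rewrite b0 g0 polar_base velocity_base.
have H0 : H (b 0) = 1 by rewrite b0 height_base.
have H1 : H (dcurve b 0) = 0.
  rewrite -g0 -b0; apply: ipw_dcurve_sphere b1 => s.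
  exact: manifold_sphere (bM s).
rewrite H1 in dH.
have dS := is_derive_fsum (index_enum I) (fun i =>
  is_derive_mul (is_derive_cst ((d i)%:R : R) (0 : R) 1) (dX i)).
have dQ := is_derive_fsum (index_enum I) (fun i =>
  is_derive_mul (is_derive_cst ((d i)%:R : R) (0 : R) 1) (is_derive_mul (dX i) (dX i))).
have d1 := is_derive_mul (is_derive_mul dH dH) dA.
have d2 := is_derive_add (is_derive_mul (is_derive_mul (is_derive_mul dH dH) dH)
    (is_derive_cst (H g'') (0 : R) 1))
  (is_derive_mul dH (is_derive_add (is_derive_mul dS dS)
    (is_derive_mul (is_derive_cst (-1 : R) (0 : R) 1) dQ))).
rewrite (cubic_identity erefl bM) in d1.
have := is_derive_inj d1 d2.
have -> : \sum_i cst (d i)%:R (0 : R) * X velocity i (b 0) = 0.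
  by rewrite big1 // => i _; rewrite X0 mulr0.
have -> : \sum_i (0 * (X velocity i (b 0) * X velocity i (b 0)) + cst (d i)%:R (0 : R) *
    (X velocity i (dcurve b 0) * X velocity i (b 0) +
     X velocity i (b 0) * X velocity i (dcurve b 0))) = 0.
  by rewrite big1 // => i _; rewrite X0; ring.
rewrite H0 (ipwC w (dcurve b 0)) /cst; set k := ipw w g'' (dcurve b 0). lra.
Qed.

End Curve.

(** This supplies [gN] for geodesics. [polar_tangent] asks for a unit [y i], so a nonzero [y i] is
    normalised, using linearity of the pairing in [y i]. *)
Lemma geodesic_polar g t0 : is_geodesic w M g -> g t0 = e *: Phi a ->
  forall y i, dot (a i) (y i) = 0 -> X y i (dcurve (dcurve g) t0) = 0.
Proof.
move=> [gM [g1 [g2 gT]]] g0 y i ay.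
pose A := acceleration g t0.
have AE z : X z i (dcurve (dcurve g) t0) = dot (z i) (A i).
  exact: accelerationE gM (conj g1 g2) _ _.
have [y0|y0] := eqVneq (dot (y i) (y i)) 0.
  by rewrite AE (dot_eq0 y0) /dot big1 // => j _; rewrite mul0r.
pose r := Num.sqrt (dot (y i) (y i)).
have r2 : r ^+ 2 = dot (y i) (y i) by rewrite sqr_sqrtr ?dot_ge0.
have r0 : r != 0 by rewrite -sqrf_eq0 r2.
pose z : fam := fun k j => r^-1 * y k j.
have az : dot (a i) (z i) = 0 by rewrite dotZ ay mulr0.
have z1 : dot (z i) (z i) = 1.
  by rewrite dotZ dotC dotZ -r2; field.
have := polar_tangent e2 a1 az z1; rewrite -g0 => /gT.
rewrite mulrC -scalerA ipwZr => /eqP; rewrite mulf_eq0 pnatr_eq0.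
rewrite eqn0Ngt (d_gt0 PM) /= => /eqP; rewrite !AE dotC dotZ dotC => /eqP.
by rewrite mulf_eq0 invr_eq0 (negbTE r0) => /eqP.
Qed.

End BasePoint.
End PowerManifold.

(** * The Bombieri-Weyl product of powers of linear forms *)

Section Multinomial.
Context {R : realType} {n : nat}.
Implicit Types (l : 'I_n.+1 -> R).

Lemma linformE l : linform l = \sum_j l j *: mpolyX R U_(j).
Proof.
apply: eq_bigr => j _; congr (_ *: mpolyX _ _); apply/mnmP => i.
by rewrite !mnmE eq_sym.
Qed.

Lemma mderiv_linform l j : mderiv j (linform l) = mpolyC n.+1 (l j).
Proof.
rewrite linformE raddf_sum /= (bigD1 j) //= mderivZ mderivX big1 => [|i ij].
  have -> : (U_(j) - U_(j))%MM = 0%MM :> mpoly.multinom n.+1.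
    by apply/mnmP => i; rewrite mnmBE mnm0E subnn.
  by rewrite mnm1E eqxx scale1r mpolyX0 addr0 -mul_mpolyC mulr1.
by rewrite mderivZ mderivX mnm1E (negbTE ij) scale0r scaler0.
Qed.

Lemma mderiv_linformX l j k :
  mderiv j (linform l ^+ k.+1) = (k.+1%:R * l j) *: linform l ^+ k.
Proof.
elim: k => [|k IH].
  by rewrite expr1 expr0 mderiv_linform mul1r -mul_mpolyC mulr1.
rewrite exprS mderivM IH mderiv_linform mul_mpolyC -scalerAr -exprS -scalerDl.
by congr (_ *: _); rewrite -[k.+2]add1n natrD; ring.
Qed.

(** The multinomial theorem with denominators cleared, by induction on the degree: differentiate in
    a variable that occurs in [m]. *)
Lemma mcoeff_linformX l k (m : mpoly.multinom n.+1) : mdeg m = k ->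
  mcoeff m (linform l ^+ k) * ((\prod_j (m j)`!)%N)%:R = k`!%:R * \prod_j l j ^+ m j.
Proof.
elim: k m => [|k IH] m mk.
  have -> : m = 0%MM by apply/eqP; rewrite -mdeg_eq0 mk.
  rewrite expr0 mcoeff1 eqxx !big1 ?mul1r // => j _; rewrite ?mnm0E ?expr0 //.
have [j mj] : exists j, (0 < m j)%N.
  apply/existsP; rewrite -[X in is_true X]negbK; apply/negP; rewrite negb_exists => /forallP h.
  move: mk; rewrite mdegE big1 // => j _; by apply/eqP; rewrite -leqn0 leqNgt h.
pose p := (m - U_(j))%MM.
have mE : m = (p + U_(j))%MM.
  by rewrite /p submK // lep1mP -lt0n.
have pk : mdeg p = k by move: mk; rewrite mE mdegD mdeg1 addn1 => -[].
have h := mcoeff_mderiv j (linform l ^+ k.+1) p.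
rewrite mderiv_linformX mcoeffZ -mE in h.
have mjE : m j = (p j).+1 by rewrite mE mnmDE mnm1E eqxx addn1.
have miE i : i != j -> m i = p i.
  by move=> ij; rewrite mE mnmDE mnm1E eq_sym (negbTE ij) addn0.
have := IH p pk.
rewrite (bigD1 j) //= [X in _ = _ * X -> _](bigD1 j) //=.
rewrite [X in _ -> _ * X%:R = _](bigD1 j) //= [X in _ -> _ = _ * X](bigD1 j) //=.
have -> : (\prod_(i < n.+1 | i != j) (m i)`! = \prod_(i < n.+1 | i != j) (p i)`!)%N.
  by apply: eq_bigr => i ij; rewrite miE.
have -> : \prod_(i < n.+1 | i != j) l i ^+ m i = \prod_(i < n.+1 | i != j) l i ^+ p i.
  by apply: eq_bigr => i ij; rewrite miE.
rewrite mjE !factS !natrM (exprS (l j)) => e.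
transitivity ((mcoeff m (linform l ^+ k.+1) *+ (p j).+1) *
   ((p j)`!%:R * (\prod_(i < n.+1 | i != j) (p i)`!)%N%:R)).
  by rewrite -(mulr_natr (mcoeff m _)); ring.
rewrite -h.
transitivity (k.+1%:R * l j * (mcoeff p (linform l ^+ k) * 
    ((p j)`!%:R * (\prod_(i < n.+1 | i != j) (p i)`!)%N%:R))); first by ring.
by rewrite e; ring.
Qed.

Variable d : nat.

Lemma bw_weight_gt0 (A : mon n d) : 0 < bw_weight R A.
Proof.
rewrite divr_gt0 // ltr0n ?fact_gt0 //.
by rewrite prodn_gt0 // => j; rewrite fact_gt0.
Qed.

Lemma mdeg_mon (A : mon n d) : mdeg (mon_to_multinom A) = d.
Proof.
rewrite mdegE; have /eqP hA := valP A; rewrite -[RHS]hA.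
by apply: eq_bigr => j _; rewrite mnmE.
Qed.

Lemma powform_coord l (A : mon n d) :
  powform d l A = (bw_weight R A)^-1 * \prod_j l j ^+ (val A j : nat).
Proof.
rewrite ffunE; have := mcoeff_linformX l (mdeg_mon A).
have -> : (\prod_j (mon_to_multinom A j)`! = \prod_j (val A j : nat)`!)%N.
  by apply: eq_bigr => j _; rewrite mnmE.
have -> : \prod_j l j ^+ mon_to_multinom A j = \prod_j l j ^+ (val A j : nat).
  by apply: eq_bigr => j _; rewrite mnmE.
rewrite /bw_weight invf_div mulrAC => <-; rewrite mulfK //.
by rewrite pnatr_eq0 -lt0n prodn_gt0 // => j; rewrite fact_gt0.
Qed.

Lemma linform_homog l : linform l ^+ d \is d.-homog.
Proof.
have h : linform l \is 1.-homog.
  by rewrite linformE; apply: rpred_sum => j _; apply: rpredZ; rewrite dhomogX /= mdeg1.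
by have := dhomogMn d h; rewrite mul1n.
Qed.

Lemma mon_to_multinom_inj : injective (@mon_to_multinom n d).
Proof.
move=> A B e; apply/val_inj/ffunP => j; apply/val_inj.
by have := congr1 (fun m : mpoly.multinom n.+1 => m j) e; rewrite !mnmE.
Qed.

Lemma mon_of_multinom (m : mpoly.multinom n.+1) : mdeg m = d ->
  exists A : mon n d, mon_to_multinom A = m.
Proof.
move=> md.
have mj j : (m j < d.+1)%N by rewrite ltnS -md mdegE (bigD1 j) //= leq_addr.
pose f := [ffun j => Ordinal (mj j)].
have hf : (\sum_j (f j : nat))%N == d.
  by rewrite -[X in _ == X]md mdegE; apply/eqP/eq_bigr => j _; rewrite ffunE.
exists (Sub f hf); apply/mnmP => j; by rewrite mnmE SubK ffunE.
Qed.

Lemma sum_powform l : \sum_A powform d l A = (\sum_j l j) ^+ d.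
Proof.
(* Evaluation at the all-ones point adds up the coefficients. *)
have -> : (\sum_j l j) ^+ d = meval (fun=> 1) (linform l ^+ d).
  rewrite rmorphXn /= linformE raddf_sum /=; congr (_ ^+ _).
  by apply: eq_bigr => j _; rewrite mevalZ mevalXU mulr1.
rewrite mevalE; set p := linform l ^+ d.
have -> : \sum_(m <- msupp p) mcoeff m p * \prod_i 1 ^+ m i = \sum_(m <- msupp p) mcoeff m p.
  by apply: eq_bigr => m _; rewrite big1 ?mulr1 // => i _; rewrite expr1n.
pose s := [seq mon_to_multinom A | A <- index_enum (mon n d)].
have us : uniq s by rewrite map_inj_uniq ?index_enum_uniq //; apply: mon_to_multinom_inj.
have -> : \sum_A powform d l A = \sum_(m <- s) mcoeff m p.
  by rewrite big_map; apply: eq_bigr => A _; rewrite ffunE.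
(* By homogeneity every monomial in the support comes from an exponent vector of degree [d]; the
   remaining ones have coefficient 0. *)
have hs : perm_eq (msupp p) [seq m <- s | m \in msupp p].
  apply: uniq_perm; rewrite ?msupp_uniq ?filter_uniq // => m.
  rewrite mem_filter; case: (boolP (m \in msupp p)) => //= mp; apply/esym.
  have [A <-] := mon_of_multinom (dhomog_mf (linform_homog l) mp).
  by apply: map_f; rewrite mem_index_enum.
rewrite (perm_big _ hs) /= big_filter [in RHS]big_mkcond /=; apply: eq_bigr => m _.
by case: ifPn => // /memN_msupp_eq0.
Qed.

(** One weight cancels against the two inverse weights of the coordinates, leaving the coefficients
    of the power of the form with coefficients [l j * l' j], which [sum_powform] adds up. *)
Lemma powform_ipw l l' :
  ipw (@bw_weight R n d) (powform d l) (powform d l') = dot l l' ^+ d.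
Proof.
rewrite /dot -sum_powform; apply: eq_bigr => A _; rewrite !powform_coord.
under [in RHS]eq_bigr do rewrite exprMn.
by rewrite big_split /=; have := bw_weight_gt0 A => /lt0r_neq0 ?; field.
Qed.

End Multinomial.

Lemma derivable_prod (R : realType) (I : Type) (s : seq I) (F : I -> R -> R) (t : R) :
  (forall i, derivable (F i) t 1) -> derivable (fun x => \prod_(i <- s) F i x) t 1.
Proof.
move=> h; elim: s => [|i s IH].
  rewrite (_ : (fun x => _) = cst 1); first exact: derivable_cst.
  by apply/funext => x; rewrite big_nil.
rewrite (_ : (fun x => _) = (fun x => F i x * \prod_(j <- s) F j x)).
  exact: (derivableM (h i) IH).
by apply/funext => x; rewrite big_cons.
Qed.

Lemma powform_derivable (R : realType) (n d : nat) (c : R -> 'I_n.+1 -> R) t :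
  (forall j, derivable (fun s => c s j) t 1) ->
  curve_derivable (fun s => powform d (c s)) t.
Proof.
move=> h A.
have -> : (fun s => powform d (c s) A) =
    (fun s => (bw_weight R A)^-1 * \prod_j c s j ^+ (val A j : nat)).
  by apply/funext => s; rewrite powform_coord.
apply: derivableM; first exact: derivable_cst.
by apply: derivable_prod => j; have [] := is_derive_expn (val A j) (derivableP (h j)).
Qed.

Lemma VsetP (R : realType) (n d : nat) (f : Hpoly R n d) : (0 < d)%N ->
  Vset R n d f <-> exists (e : R) (a : 'I_n.+1 -> R),
    [/\ e ^+ 2 = 1, dot a a = 1 & f = e *: powform d a].
Proof.
move=> d0; split.
  move=> [[a [e [eE fE]]]]; move/nrmw1 => /(_ (@bw_weight_gt0 _ _ _)) f1.
  have e2 : e ^+ 2 = 1 by case: eE => ->; rewrite ?sqrrN expr1n.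
  rewrite fE ipwZl ipwZr powform_ipw mulrA -expr2 e2 mul1r in f1.
  by exists e, a; split=> //; apply/eqP; rewrite -(pexpr_eq1 d0) ?dot_ge0 // f1.
move=> [e [a [e2 a1 fE]]]; split.
  exists a, e; split=> //; have /eqP : (e - 1) * (e + 1) = 0 by rewrite -subr_sqr e2 expr1n subrr.
  by rewrite mulf_eq0 subr_eq0 addr_eq0 => /orP[] /eqP; [left|right].
apply/nrmw1; first exact: bw_weight_gt0.
by rewrite fE ipwZl ipwZr powform_ipw a1 expr1n mulr1 -expr2.
Qed.

(** A family over ['I_1], which makes a single factor an instance of [power_manifold]. *)
Definition vpow {R : realType} {n : nat} (d : nat) (u : forall i : 'I_1, 'I_n.+1 -> R) :
  Hpoly R n d := powform d (u ord0).

Lemma Vset_power_manifold (R : realType) (n d : nat) : (0 < d)%N ->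
  power_manifold (fun=> d) (@bw_weight R n d) (vpow d) (Vset R n d).
Proof.
move=> d0; split=> //.
- exact: bw_weight_gt0.
- by move=> u v; rewrite /vpow powform_ipw big_ord1.
- by move=> c t h; apply: powform_derivable => j; apply: h.
move=> f; split.
  move=> /(VsetP _ d0) [e [a [e2 a1 ->]]]; exists e, (fun=> a); by split.
move=> [e [a [e2 a1 ->]]]; apply/VsetP => //; exists e, (a ord0); by split.
Qed.

(** The index sets vary with [i]: [fprod] passes to functions into the tagged union, where product
    distributes over sum as usual. *)
Lemma prod_sum_dffun (R : comPzRingType) (I : finType) (T : I -> finType)
    (F : forall i, T i -> R) :
  \prod_i \sum_(x : T i) F i x = \sum_(A : {dffun forall i, T i}) \prod_i F i (A i).
Proof.
pose P i : {ffun T i -> R} := [ffun x => F i x].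
transitivity (\sum_(t : fprod T) \prod_(i in I) P i (t i)).
  rewrite (@big_fprod R 0 1 *%R +%R I T P).
  rewrite -(bigA_distr_big_dep _ (fun i => untag 0 (P i))).
  apply: eq_bigr => i _; rewrite -(big_tag (fun i x => P i x)).
  by apply: eq_bigr => x _; rewrite ffunE.
rewrite (reindex (@dffun_of_fprod _ T)); last exact/onW_bij/dffun_of_fprod_bij.
by apply: eq_bigr => t _; apply: eq_bigr => i _; rewrite !ffunE.
Qed.

(** * Tensor products of powers of linear forms *)

Section Tensor.
Context {R : realType} {r : nat}.
Variables (n d : 'I_r -> nat).
Implicit Types f g : forall i : 'I_r, Hpoly R (n i) (d i).

Lemma tens_weight_gt0 (A : tidx n d) : 0 < tens_weight R A.
Proof. by apply: prodr_gt0 => i _; apply: bw_weight_gt0. Qed.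

Lemma tens_ipw f g : ipw (@tens_weight R r n d) (tens f) (tens g) =
  \prod_i ipw (@bw_weight R (n i) (d i)) (f i) (g i).
Proof.
rewrite /ipw prod_sum_dffun; apply: eq_bigr => A _.
by rewrite !ffunE /tens_weight !big_split.
Qed.

Lemma tens_scale (k : 'I_r -> R) f : tens (fun i => k i *: f i) = (\prod_i k i) *: tens f.
Proof.
apply/ffunP => A; rewrite !ffunE -[RHS]/(_ * _) -big_split /=.
by apply: eq_bigr => i _; rewrite ffunE.
Qed.

Definition tpow (u : forall i : 'I_r, 'I_(n i).+1 -> R) : Htens R n d :=
  tens (fun i => powform (d i) (u i)).

Lemma Xset_power_manifold (l : 'I_r) : (forall i, 0 < d i)%N ->
  power_manifold d (@tens_weight R r n d) tpow (Xset R r n d).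
Proof.
move=> d0; split=> //.
- exact: tens_weight_gt0.
- by move=> u v; rewrite tens_ipw; apply: eq_bigr => i _; rewrite powform_ipw.
- move=> c t h A.
  have -> : (fun s => tpow (c s) A) =
      (fun s => \prod_i powform (d i) (c s i) (A i)).
    by apply/funext => s; rewrite ffunE.
  apply: derivable_prod => i; exact: powform_derivable.
move=> F; split.
  move=> [f [fV ->]].
  have H i : {p : R * ('I_(n i).+1 -> R) |
      [/\ p.1 ^+ 2 = 1, dot p.2 p.2 = 1 & f i = p.1 *: powform (d i) p.2]}.
    by apply: cid; have [e [a ?]] := (VsetP _ (d0 i)).1 (fV i); exists (e, a).
  exists (\prod_i (sval (H i)).1), (fun i => (sval (H i)).2); split.
  - rewrite -prodrXl big1 // => i _; by have [] := svalP (H i).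
  - by move=> i; have [] := svalP (H i).
  rewrite -tens_scale; congr tens; apply/functional_extensionality_dep => i.
  by have [_ _] := svalP (H i).
move=> [e [a [e2 a1 ->]]].
(* The global sign is carried by the single factor [l]. *)
exists (fun i => (if i == l then e else 1) *: powform (d i) (a i)); split.
  move=> i; apply/(VsetP _ (d0 i)); exists (if i == l then e else 1), (a i).
  by split=> //; case: ifP => // _; rewrite expr1n.
rewrite tens_scale -/(tpow a); congr (_ *: _).
by rewrite (bigD1 l) //= eqxx big1 ?mulr1 // => i /negbTE ->.
Qed.

End Tensor.

Arguments tpow {R r n} d u.
Arguments Xset_power_manifold R {r} n {d} l _.

(** * Products of geodesics *)

Lemma jet2_prod (R : realType) (I : Type) (s : seq I) (F : I -> R -> R) (t : R) :
  (forall i, exists x0 x1 x2, jet2 (F i) t x0 x1 x2) ->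
  exists x0 x1 x2, jet2 (fun x => \prod_(i <- s) F i x) t x0 x1 x2.
Proof.
move=> h; elim: s => [|i s [x0 [x1 [x2 IH]]]].
  exists 1, 0, 0; rewrite (_ : (fun x => _) = cst 1); first exact: jet2_cst.
  by apply/funext => x; rewrite big_nil.
have [y0 [y1 [y2 hi]]] := h i; do 3!eexists.
rewrite (_ : (fun x => _) = (fun x => F i x * \prod_(j <- s) F j x)).
  exact: (jet2M hi IH).
by apply/funext => x; rewrite big_cons.
Qed.

Lemma twice_derivableP (R : realType) (J : finType) (c : R -> {ffun J -> R}) :
  twice_derivable c <->
  forall t j, exists x0 x1 x2, jet2 (fun s => c s j) t x0 x1 x2.
Proof.
split=> [[h1 h2] t j|h].
  exists (c t j), (dcurve c t j), (dcurve (dcurve c) t j); split=> //.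
  exists (fun s => dcurve c s j); split=> //; last exact: is_derive_coord.
  by move=> s; apply: is_derive_coord.
split=> t j; have [x0 [x1 [x2 [_ [f' [hf _ h2]]]]]] := h t j.
  by case: (hf t).
rewrite (_ : (fun s => dcurve c s j) = f'); first by case: h2.
by apply/funext => s; rewrite ffunE derive1E; case: (hf s).
Qed.

Lemma geodesic_invariants (R : realType) (I J : finType) (n d : I -> nat) (w : J -> R)
    (Phi : (forall i : I, 'I_(n i).+1 -> R) -> {ffun J -> R}) (M : set {ffun J -> R})
    (g : R -> {ffun J -> R}) (t : R) :
  power_manifold d w Phi M -> is_geodesic w M g ->
  exists s : I -> R, let S := \sum_i (d i)%:R * s i in
  [/\ forall i, 0 <= s i, ipw w (dcurve g t) (dcurve g t) = S &
      ipw w (dcurve (dcurve g) t) (dcurve (dcurve g) t) =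
      S ^+ 2 + 2 * (S ^+ 2 - \sum_i (d i)%:R * s i ^+ 2)].
Proof.
move=> PM geo; have [gM [g1 [g2 _]]] := geo.
have [e [a [e2 a1 gt]]] := (manifoldP PM (g t)).1 (gM t).
have gN := geodesic_polar PM e2 a1 geo gt.
(* [s i] is the squared length of the [i]-th chart velocity at the base point [g t]. *)
exists (fun i => dot (velocity d w Phi e a g t (i := i)) (velocity d w Phi e a g t (i := i))).
split; first by move=> i; apply: dot_ge0.
  exact: (speedE PM e2 a1 gM (conj g1 g2) gt gN).
exact: (accelE PM e2 a1 gM (conj g1 g2) gt gN).
Qed.

Section TensorCurve.
Context {R : realType} {r : nat}.
Variables (n d : 'I_r -> nat) (l : 'I_r).
Hypothesis d0 : forall i, (0 < d i)%N.
Local Notation bw i := (@bw_weight R (n i) (d i)).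
Local Notation tw := (@tens_weight R r n d).
Local Notation vpolar a y i :=
  (polar (fun=> d i) (vpow (d i)) (fun=> a i) (fun=> y i) (ord0 : 'I_1)).

(** Links the coordinates of the product to those of factor [i]; the other factors enter only
    through their heights. *)
Lemma tens_ipw_polar (c : forall i, Hpoly R (n i) (d i)) (e : 'I_r -> R)
    (a y : forall i, 'I_(n i).+1 -> R) (i : 'I_r) :
  (forall k, Vset R (n k) (d k) (c k)) ->
  ipw tw (tens c) ((\prod_k e k) *: polar d (tpow d) a y i) =
  ipw (bw i) (c i) (e i *: vpolar a y i) *
  \prod_(k | k != i) ipw (bw k) (c k) (e k *: powform (d k) (a k)).
Proof.
move=> cV.
have H k : {p : R * ('I_(n k).+1 -> R) | c k = p.1 *: powform (d k) p.2}.
  by apply: cid; have [f [b [_ _ ?]]] := (VsetP _ (d0 k)).1 (cV k); exists (f, b).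
pose f k := (sval (H k)).1; pose b k := (sval (H k)).2.
have cE k : c k = f k *: powform (d k) (b k) := svalP (H k).
have -> : tens c = (\prod_k f k) *: tpow d b.
  by rewrite -tens_scale; congr tens; apply/functional_extensionality_dep.
rewrite ipwZl (ipwZr tw (\prod_k e k)) (polar_ipw (Xset_power_manifold R n l d0)).
have -> : \prod_(k | k != i) ipw (bw k) (c k) (e k *: powform (d k) (a k)) =
    (\prod_(k | k != i) f k) * ((\prod_(k | k != i) e k) *
    \prod_(k | k != i) dot (b k) (a k) ^+ d k).
  rewrite -!big_split /=; apply: eq_bigr => k _.
  by rewrite cE ipwZl ipwZr powform_ipw.
rewrite cE ipwZl (ipwZr (bw i) (e i)) -[powform _ _]/(vpow (d i) (fun=> b i)).
rewrite (polar_ipw (Vset_power_manifold R (n i) (d0 i))).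
have -> : \prod_(k : 'I_1 | k != ord0) dot (b i) (a i) ^+ d i = 1.
  by rewrite big1 // => k; rewrite (ord1 k) eqxx.
rewrite [\prod_k f k](bigD1 i) //= [\prod_k e k](bigD1 i) //=; ring.
Qed.

Variable c : forall i : 'I_r, R -> Hpoly R (n i) (d i).
Hypothesis c_geo : forall i, is_geodesic (bw i) (Vset R (n i) (d i)) (c i).

Lemma tens_curve_in t : Xset R r n d (tens_curve c t).
Proof. by exists (fun i => c i t); split=> // i; have [cV _] := c_geo i. Qed.

Lemma tens_curve_twice_derivable : twice_derivable (tens_curve c).
Proof.
apply/twice_derivableP => t A.
have -> : (fun s => tens_curve c s A) = (fun s => \prod_i c i s (A i)).
  by apply/funext => s; rewrite ffunE.
apply: jet2_prod => i; have [_ [c1 [c2 _]]] := c_geo i.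
by have /twice_derivableP := conj c1 c2; apply.
Qed.

(* The pairings of the other factors with their values at [t] are stationary there. *)
Lemma tens_curve_polar (e : 'I_r -> R) (a : forall i, 'I_(n i).+1 -> R) t :
  (forall i, e i ^+ 2 = 1) -> (forall i, dot (a i) (a i) = 1) ->
  (forall i, c i t = e i *: powform (d i) (a i)) ->
  forall i (y : forall k, 'I_(n k).+1 -> R),
  ipw tw (dcurve (tens_curve c) t) ((\prod_k e k) *: polar d (tpow d) a y i) =
    ipw (bw i) (dcurve (c i) t) (e i *: vpolar a y i) /\
  (dot (a i) (y i) = 0 -> ipw tw (dcurve (dcurve (tens_curve c)) t)
     ((\prod_k e k) *: polar d (tpow d) a y i) = 0).
Proof.
move=> e2 a1 ct i y.
have PV k := Vset_power_manifold R (n k) (d0 k).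
have cV k s : Vset R (n k) (d k) (c k s) by have [h _] := c_geo k.
have c2 k : twice_derivable (c k) by have [_ [h1 [h2 _]]] := c_geo k.
have jk k : logjet2 (fun s => ipw (bw k) (c k s) (e k *: powform (d k) (a k))) t 0
    (ipw (bw k) (dcurve (dcurve (c k)) t) (e k *: powform (d k) (a k))).
  have := jet2_ipw (bw k) t (e k *: powform (d k) (a k)) (c2 k).
  have ck : c k t = e k *: vpow (d k) (fun=> a k) by rewrite ct.
  have -> := height_base (PV k) (cV k) ck.
  have -> := height_velocity (PV k) (cV k) (c2 k) ck.
  by move=> /jet2_log; rewrite expr0n subr0.
have ji := jet2_ipw (bw i) t (e i *: vpolar a y i) (c2 i).
have jp := logjet2_prod (index_enum 'I_r) (fun k => k != i) jk.
have j1 := jet2M ji jp.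
have j2 := jet2_ipw tw t ((\prod_k e k) *: polar d (tpow d) a y i)
  tens_curve_twice_derivable.
have eq12 : (fun s => ipw tw (tens_curve c s) ((\prod_k e k) *: polar d (tpow d) a y i)) =
   (fun s => ipw (bw i) (c i s) (e i *: vpolar a y i) *
     \prod_(k | k != i) ipw (bw k) (c k s) (e k *: powform (d k) (a k))).
  by apply/funext => s; rewrite tens_ipw_polar.
rewrite eq12 in j2; have [_ h1 h2] := jet2_inj j2 j1.
split; first by rewrite h1 big1 // mulr1 mulr0 addr0.
(* Leibniz rule: the terms vanish since [c i] is a geodesic, the other factors are stationary, and
   [y i] is orthogonal to [a i]. *)
move=> ay; rewrite h2 big1 //.
have ci : c i t = e i *: vpow (d i) (fun=> a i) by rewrite ct.
have -> : ipw (bw i) (c i t) (e i *: vpolar a y i) = 0.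
  by rewrite ci (polar_base (PV i) (e2 i)) // => ?; apply: a1.
have -> : ipw (bw i) (dcurve (dcurve (c i)) t) (e i *: vpolar a y i) = 0.
  by apply: (geodesic_polar (PV i) (e2 i) _ (c_geo i) ci).
by rewrite mul0r !mulr0 mul0r !addr0.
Qed.

(** Base points of the factors multiply to one of the product. [tens_curve_polar] gives normality in
    the polarised directions, hence a geodesic, and equates the chart velocities with those of the
    factors, which [speedE] for one factor turns into squared speeds. *)
Lemma tens_curve_geodesic : is_geodesic tw (Xset R r n d) (tens_curve c) /\
  forall t, exists s : 'I_r -> R, let S := \sum_i (d i)%:R * s i in
  [/\ forall i, (d i)%:R * s i = ipw (bw i) (dcurve (c i) t) (dcurve (c i) t),
      ipw tw (dcurve (tens_curve c) t) (dcurve (tens_curve c) t) = S &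
      ipw tw (dcurve (dcurve (tens_curve c)) t) (dcurve (dcurve (tens_curve c)) t) =
      S ^+ 2 + 2 * (S ^+ 2 - \sum_i (d i)%:R * s i ^+ 2)].
Proof.
have PX := Xset_power_manifold R n l d0.
have PV k := Vset_power_manifold R (n k) (d0 k).
have base t : {ea : ('I_r -> R) * (forall i, 'I_(n i).+1 -> R) |
    [/\ forall i, ea.1 i ^+ 2 = 1, forall i, dot (ea.2 i) (ea.2 i) = 1 &
        forall i, c i t = ea.1 i *: powform (d i) (ea.2 i)]}.
  have H k : {p : R * ('I_(n k).+1 -> R) |
      [/\ p.1 ^+ 2 = 1, dot p.2 p.2 = 1 & c k t = p.1 *: powform (d k) p.2]}.
    apply: cid; have [cV _] := c_geo k.
    by have [f [b ?]] := (VsetP _ (d0 k)).1 (cV t); exists (f, b).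
  by exists (fun k => (sval (H k)).1, fun k => (sval (H k)).2); split=> k;
    have [] := svalP (H k).
have g2 := tens_curve_twice_derivable; have gM := tens_curve_in.
have gt t : tens_curve c t =
    (\prod_k (sval (base t)).1 k) *: tpow d (sval (base t)).2.
  have [_ _ ct] := svalP (base t).
  by rewrite -tens_scale; congr tens; apply/functional_extensionality_dep.
have e1 t : (\prod_k (sval (base t)).1 k) ^+ 2 = 1.
  by have [h _ _] := svalP (base t); rewrite -prodrXl big1.
have gN t y i : dot ((sval (base t)).2 i) (y i) = 0 ->
    ipw tw (dcurve (dcurve (tens_curve c)) t)
      ((\prod_k (sval (base t)).1 k) *: polar d (tpow d) (sval (base t)).2 y i) = 0.
  have [e2 a1 ct] := svalP (base t).
  by have [_] := tens_curve_polar e2 a1 ct i y.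
split.
  split; first exact: gM.
  split; first exact: g2.1.
  split; first exact: g2.2.
  move=> t v; have [_ a1 _] := svalP (base t).
  exact: (normal_acceleration PX (e1 t) a1 gM g2 (gt t) (gN t)).
move=> t; have [e2 a1 ct] := svalP (base t).
set e := (sval (base t)).1 in e2 ct *; set a := (sval (base t)).2 in a1 ct *.
exists (fun i => dot (velocity d tw (tpow d) (\prod_k e k) a (tens_curve c) t (i := i))
  (velocity d tw (tpow d) (\prod_k e k) a (tens_curve c) t (i := i))).
split; last 2 first.
- exact: (speedE PX (e1 t) a1 gM g2 (gt t) (gN t)).
- exact: (accelE PX (e1 t) a1 gM g2 (gt t) (gN t)).
move=> i; have [cV [c1 [c2 _]]] := c_geo i.
have ci : c i t = e i *: vpow (d i) (fun=> a i) by rewrite ct.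
have a1' (k : 'I_1) : dot (a i) (a i) = 1 by [].
rewrite (speedE (PV i) (e2 i) a1' cV (conj c1 c2) ci
  (geodesic_polar (PV i) (e2 i) a1' (c_geo i) ci)) big_ord1.
congr (_ * _); apply: eq_bigr => j _.
suff E : velocity d tw (tpow d) (\prod_k e k) a (tens_curve c) t (i := i) j =
  velocity (fun=> d i) (bw i) (vpow (d i)) (e i) (fun=> a i) (c i) t (i := ord0) j by rewrite !E.
by have [h _] := tens_curve_polar e2 a1 ct i (@unit_vector R 'I_r n j).
Qed.

End TensorCurve.

Lemma constant_geodesic (R : realType) (J : finType) (w : J -> R)
    (M : set {ffun J -> R}) (f : {ffun J -> R}) :
  M f -> is_geodesic w M (fun=> f) /\ forall t, dcurve (fun=> f) t = 0 :> {ffun J -> R}.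
Proof.
move=> Mf.
have D (h : {ffun J -> R}) t : curve_derivable (fun=> h) t by move=> j; apply: derivable_cst.
have E (h : {ffun J -> R}) : dcurve (fun=> h) = fun=> 0.
  by apply/funext => t; apply/ffunP => j; rewrite !ffunE derive1_cst.
split; last by move=> t; rewrite E.
split=> //; split; first exact: D.
split; first by rewrite E; apply: D.
by move=> t v _; rewrite !E ipwC ipw0r.
Qed.

(* With [p i = d i * s i] summing to [1], this is [1 / D <= \sum_i p i ^+ 2 / d i <= 1 / d l]. *)
Lemma weighted_square_bounds (R : realFieldType) (I : finType) (d : I -> nat) (l : I) (s : I -> R) :
  (forall i, 0 < d i)%N -> (forall i, d l <= d i)%N -> (forall i, 0 <= s i) ->
  \sum_i (d i)%:R * s i = 1 ->
  ((\sum_i d i)%N%:R)^-1 <= \sum_i (d i)%:R * s i ^+ 2 <= (d l)%:R^-1.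
Proof.
move=> d0 dl s0 s1.
have dR i : 0 < (d i)%:R :> R by rewrite ltr0n.
have ds0 i : 0 <= (d i)%:R * s i by rewrite mulr_ge0 // ltW.
have ds1 i : (d i)%:R * s i <= 1.
  by rewrite -[leRHS]s1 (bigD1 i) //= lerDl sumr_ge0.
set D : R := (\sum_i d i)%N%:R.
have D0 : 0 < D by rewrite ltr0n (bigD1 l) //= ltn_addr.
have DE : \sum_i (d i)%:R = D by rewrite /D natr_sum.
apply/andP; split.
  (* The weights [d i] give [s] the mean [D^-1]; the lower bound is nonnegativity of the
     variance. *)
  have : 0 <= \sum_i (d i)%:R * (s i - D^-1) ^+ 2.
    by apply: sumr_ge0 => i _; rewrite mulr_ge0 ?sqr_ge0 // ltW.
  have -> : \sum_i (d i)%:R * (s i - D^-1) ^+ 2 =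
      \sum_i (d i)%:R * s i ^+ 2 - 2 * D^-1 * (\sum_i (d i)%:R * s i)
      + D^-1 ^+ 2 * (\sum_i (d i)%:R).
    by rewrite !mulr_sumr -sumrB -big_split /=; apply: eq_bigr => i _; ring.
  rewrite s1 DE; have -> : D^-1 ^+ 2 * D = D^-1 by rewrite expr2 mulfVK ?gt_eqF.
  lra.
(* Termwise, [d l * d i * s i ^+ 2 <= (d i * s i) ^+ 2 <= d i * s i], as [d i * s i] lies in
   [0, 1]. *)
rewrite -(ler_pM2l (dR l)) mulfV ?gt_eqF // mulr_sumr -[X in _ <= X]s1.
apply: ler_sum => i _.
apply: (@le_trans _ _ (((d i)%:R * s i) * ((d i)%:R * s i))); last first.
  by rewrite -[X in _ <= X]mul1r ler_wpM2r.
have -> : (d l)%:R * ((d i)%:R * s i ^+ 2) = (d l)%:R * s i * ((d i)%:R * s i) by ring.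
by apply: ler_wpM2r => //; apply: ler_wpM2r; rewrite ?ler_nat.
Qed.

(** * Curvature bounds and the geodesics attaining them *)

Theorem theorem1p2 (R : realType) (r : nat) (n d : 'I_r -> nat)
  (hd_pos : forall i, (0 < d i)%N)
  (hd_ge2 : (2 <= \sum_i d i)%N)
  (l : 'I_r) (hl_min : forall i, (d l <= d i)%N) :
  let D : R := ((\sum_i d i)%N)%:R in
  let dl : R := (d l)%:R in
  let w := @tens_weight R r n d in
  let X := Xset R r n d in
  (* the bounds, for every arc-length geodesic of X and every t *)
  (forall g : R -> Htens R n d, is_geodesic w X g -> arc_length w g ->
     forall t, Num.sqrt (2 * (dl - 1) / dl) <= curvature w X g t
               <= Num.sqrt (2 * (D - 1) / D))
  /\
  (* the upper bound is attained by products of geodesics of speed sqrt(d_i/d) *)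
  (forall c : forall i : 'I_r, R -> Hpoly R (n i) (d i),
     (forall i, is_geodesic (@bw_weight R (n i) (d i)) (Vset R (n i) (d i)) (c i)
                /\ forall t, nrmw (@bw_weight R (n i) (d i)) (dcurve (c i) t)
                             = Num.sqrt ((d i)%:R / D)) ->
     is_geodesic w X (tens_curve c) /\ arc_length w (tens_curve c) /\
     forall t, curvature w X (tens_curve c) t = Num.sqrt (2 * (D - 1) / D))
  /\
  (* the lower bound is attained by gamma_l (x) constants, gamma_l arc-length *)
  (forall c : forall i : 'I_r, R -> Hpoly R (n i) (d i),
     is_geodesic (@bw_weight R (n l) (d l)) (Vset R (n l) (d l)) (c l) ->
     arc_length (@bw_weight R (n l) (d l)) (c l) ->
     (forall i, i != l -> exists f, Vset R (n i) (d i) f /\ forall t, c i t = f) ->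
     is_geodesic w X (tens_curve c) /\ arc_length w (tens_curve c) /\
     forall t, curvature w X (tens_curve c) t = Num.sqrt (2 * (dl - 1) / dl)).
Proof.
move=> D dl w X.
have PX := Xset_power_manifold R n l hd_pos.
have w0 : forall A, 0 < w A := weight_gt0 PX.
have d_gt0 i : 0 < (d i)%:R :> R by rewrite ltr0n.
have dl_gt0 : 0 < dl := d_gt0 l.
have D_gt0 : 0 < D by rewrite ltr0n (leq_trans _ hd_ge2).
have bE (x : R) : 0 < x -> 2 * (x - 1) / x = 2 - 2 * x^-1.
  by move=> x0; field; rewrite gt_eqF.
(* The last premise is the formula for |g''|^2 at total squared speed 1; removing the component
   along [g] subtracts 1. *)
have curv g t Q : is_geodesic w X g -> arc_length w g ->
    ipw w (dcurve (dcurve g) t) (dcurve (dcurve g) t) = 1 ^+ 2 + 2 * (1 ^+ 2 - Q) ->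
    curvature w X g t = Num.sqrt (2 - 2 * Q).
  move=> geo al e; rewrite (curvature_geodesic w0 t (manifold_sphere PX) geo al) e.
  by congr Num.sqrt; ring.
split; [|split].
- move=> g geo al t.
  have [s [s0 e1 e2]] := geodesic_invariants t PX geo.
  have S1 : \sum_i (d i)%:R * s i = 1 by rewrite -e1; apply/(nrmw1 w0)/al.
  rewrite S1 in e2; rewrite (curv g t _ geo al e2) !bE //.
  (* Curvature decreases in the sum of squares, so [lo] gives the upper bound and [hi] the lower
     one. *)
  have /andP[lo hi] := weighted_square_bounds hd_pos hl_min s0 S1.
  by apply/andP; split; apply: ler_wsqrtr; lra.
- move=> c hc; have c_geo i : is_geodesic (@bw_weight R (n i) (d i)) _ (c i) := (hc i).1.
  have [geo inv] := tens_curve_geodesic l hd_pos c_geo.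
  (* The prescribed speeds make all [s i] equal to [D^-1], the case of zero variance. *)
  have sE t s : (forall i, (d i)%:R * s i = ipw (@bw_weight R (n i) (d i))
      (dcurve (c i) t) (dcurve (c i) t)) -> forall i, s i = D^-1.
    move=> h i; apply: (mulfI (lt0r_neq0 (d_gt0 i))); rewrite h.
    have := (hc i).2 t; rewrite /nrmw => /eqP.
    rewrite eqr_sqrt ?ipw_ge0 //; first by move=> /eqP.
      exact: bw_weight_gt0.
    by rewrite divr_ge0 // ltW.
  have SE (k : R) : \sum_i (d i)%:R * k = D * k by rewrite -mulr_suml -natr_sum.
  have al : arc_length w (tens_curve c).
    move=> t; have [s [h e1 _]] := inv t; apply/(nrmw1 w0); rewrite e1.
    under eq_bigr do rewrite (sE t s h).
    by rewrite SE mulfV ?gt_eqF.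
  split=> //; split=> // t; have [s [h e1 e2]] := inv t.
  have S1 : \sum_i (d i)%:R * s i = 1 by rewrite -e1; apply/(nrmw1 w0)/al.
  rewrite S1 in e2; rewrite (curv _ t _ geo al e2) bE //; congr (Num.sqrt (2 - 2 * _)).
  under eq_bigr do rewrite (sE t s h).
  by rewrite SE expr2 mulVKf ?gt_eqF.
move=> c cl_geo cl_al c_cst.
have cE i : i != l -> exists f, Vset R (n i) (d i) f /\ c i = fun=> f.
  by move=> il; have [f [fV cf]] := c_cst i il; exists f; split=> //; apply/funext.
have c_geo i : is_geodesic (@bw_weight R (n i) (d i)) (Vset R (n i) (d i)) (c i).
  have [->//|il] := eqVneq i l.
  by have [f [fV ->]] := cE i il; apply: (constant_geodesic _ fV).1.
have [geo inv] := tens_curve_geodesic l hd_pos c_geo.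
(* Only factor [l] moves, at unit speed, so the whole sum sits at the index of least degree. *)
have sl t s : (forall i, (d i)%:R * s i = ipw (@bw_weight R (n i) (d i))
    (dcurve (c i) t) (dcurve (c i) t)) -> s l = dl^-1 /\ forall i, i != l -> s i = 0.
  move=> h; split.
    apply: (mulfI (lt0r_neq0 dl_gt0)); rewrite h mulfV ?gt_eqF //.
    by apply/nrmw1; [exact: bw_weight_gt0 | exact: cl_al].
  move=> i il; apply: (mulfI (lt0r_neq0 (d_gt0 i))); rewrite h mulr0.
  have [f [fV ->]] := cE i il.
  by rewrite (constant_geodesic (@bw_weight R (n i) (d i)) fV).2 ipw0r.
have al : arc_length w (tens_curve c).
  move=> t; have [s [h e1 _]] := inv t; apply/(nrmw1 w0); rewrite e1.
  have [sl1 s0] := sl t s h.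
  rewrite (bigD1 l) //= sl1 big1 => [|i il]; last by rewrite s0 // mulr0.
  by rewrite addr0 mulfV ?gt_eqF.
split=> //; split=> // t; have [s [h e1 e2]] := inv t.
have S1 : \sum_i (d i)%:R * s i = 1 by rewrite -e1; apply/(nrmw1 w0)/al.
rewrite S1 in e2; rewrite (curv _ t _ geo al e2) bE //; congr (Num.sqrt (2 - 2 * _)).
have [sl1 s0] := sl t s h.
rewrite (bigD1 l) //= sl1 big1 => [|i il]; last by rewrite s0 // expr0n mulr0.
by rewrite addr0 expr2 mulVKf ?gt_eqF.
Qed.
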